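(* Let $\mathbf C$ be a cancellative atomic Markov category with conditionals. Then for all $f_i:X\to E_i\otimes W$ and $g_i:E_i\otimes W\to Y$ ($i=1,2$), if $$(g_1\otimes\mathrm{id}_W)\circ(\mathrm{id}_{E_1}\otimes\mathrm{swap}_{W,W})\circ(f_1\otimes\mathrm{id}_W)=(g_2\otimes\mathrm{id}_W)\circ(\mathrm{id}_{E_2}\otimes\mathrm{swap}_{W,W})\circ(f_2\otimes\mathrm{id}_W)$$ as morphisms $X\otimes W\to Y\otimes W$, then $g_1\circ f_1=g_2\circ f_2$ as morphisms $X\to Y$.
   Context: A Markov category is a symmetric monoidal category $(\mathbf C,\otimes,I)$ in which every object $X$ carries a commutative comonoid $\Delta_X:X\to X\otimes X$, $\mathrm{del}_X:X\to I$, compatible with $\otimes$, and every $f:X\to Y$ satisfies $\mathrm{del}_Y\circ f=\mathrm{del}_X$. Naturality of $\Delta$ is not assumed. Coherence isomorphisms are suppressed. $\mathbf C$ has conditionals if for every $f:A\to X\otimes Y$ there is $f|_X:X\otimes A\to Y$ with $f=(\mathrm{id}_X\otimes f|_X)\circ(\Delta_X\otimes\mathrm{id}_A)\circ\big(((\mathrm{id}_X\otimes\mathrm{del}_Y)\circ f)\otimes\mathrm{id}_A\big)\circ\Delta_A$. For $p:A\to X$ and $f_1,f_2:W\otimes X\to Y$, write $f_1=_pf_2$ if $(f_1\otimes\mathrm{id}_X)\circ(\mathrm{id}_W\otimes(\Delta_X\circ p))=(f_2\otimes\mathrm{id}_X)\circ(\mathrm{id}_W\otimes(\Delta_X\circ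 p))$. For $p:A\to X$, $q:B\to X$ write $p\ll q$ if for all $W,Y$ and $f_1,f_2:W\otimes X\to Y$, $f_1=_qf_2$ implies $f_1=_pf_2$. $p:A\to X$ is atomic if $\Delta_X\circ p\ll p\otimes p$; $\mathbf C$ is atomic if all its morphisms are. An object $W$ is cancellable if $\mathrm{del}_W\otimes f_1=\mathrm{del}_W\otimes f_2$ implies $f_1=f_2$ for all parallel $f_1,f_2$; $\mathbf C$ is cancellative if all objects are cancellable. *)

(* Defs.v *)
Set Implicit Arguments.
Unset Strict Implicit.
Unset Printing Implicit Defensive.

Declare Scope markov_scope.
Delimit Scope markov_scope with markov.
Local Open Scope markov_scope.

Reserved Notation "g ∘ f" (at level 40, left associativity).
Reserved Notation "X ⊗ Y" (at level 38, left associativity).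
Reserved Notation "f ⊠ g" (at level 38, left associativity).

(* Equality of morphisms is Leibniz equality. *)
Record category := Category {
  ob :> Type;
  hom : ob -> ob -> Type;
  idm : forall X, hom X X;
  comp : forall X Y Z, hom Y Z -> hom X Y -> hom X Z
    where "g ∘ f" := (comp g f);
  comp_idl : forall X Y (f : hom X Y), idm Y ∘ f = f;
  comp_idr : forall X Y (f : hom X Y), f ∘ idm X = f;
  comp_assoc : forall W X Y Z (h : hom Y Z) (g : hom X Y) (f : hom W X),
    h ∘ (g ∘ f) = (h ∘ g) ∘ f
}.

Arguments hom {C} X Y : rename.
Arguments idm {C} X : rename.
Arguments comp {C X Y Z} g f : rename.
Notation "g ∘ f" := (comp g f) : markov_scope.

(* Not assumed strict: all structural isomorphisms are explicit. *)
Record symmetric_monoidal := SymmetricMonoidal {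
  smc_cat :> category;

  tensor : smc_cat -> smc_cat -> smc_cat
    where "X ⊗ Y" := (tensor X Y);
  tensor_hom : forall X X' Y Y' : smc_cat,
    hom X X' -> hom Y Y' -> hom (X ⊗ Y) (X' ⊗ Y')
    where "f ⊠ g" := (tensor_hom f g);
  unit_ob : smc_cat;

  tensor_idm : forall X Y, idm X ⊠ idm Y = idm (X ⊗ Y);
  tensor_comp : forall (X X' X'' Y Y' Y'' : smc_cat)
    (f' : hom X' X'') (f : hom X X') (g' : hom Y' Y'') (g : hom Y Y'),
    (f' ∘ f) ⊠ (g' ∘ g) = (f' ⊠ g') ∘ (f ⊠ g);

  assoc : forall X Y Z, hom ((X ⊗ Y) ⊗ Z) (X ⊗ (Y ⊗ Z));
  assoc_inv : forall X Y Z, hom (X ⊗ (Y ⊗ Z)) ((X ⊗ Y) ⊗ Z);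
  assocK : forall X Y Z, assoc_inv X Y Z ∘ assoc X Y Z = idm _;
  assoc_invK : forall X Y Z, assoc X Y Z ∘ assoc_inv X Y Z = idm _;
  assoc_natural : forall (X X' Y Y' Z Z' : smc_cat)
    (f : hom X X') (g : hom Y Y') (h : hom Z Z'),
    assoc X' Y' Z' ∘ ((f ⊠ g) ⊠ h) = (f ⊠ (g ⊠ h)) ∘ assoc X Y Z;

  lunit : forall X, hom (unit_ob ⊗ X) X;
  lunit_inv : forall X, hom X (unit_ob ⊗ X);
  lunitK : forall X, lunit_inv X ∘ lunit X = idm _;
  lunit_invK : forall X, lunit X ∘ lunit_inv X = idm _;
  lunit_natural : forall (X Y : smc_cat) (f : hom X Y),
    lunit Y ∘ (idm unit_ob ⊠ f) = f ∘ lunit X;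

  runit : forall X, hom (X ⊗ unit_ob) X;
  runit_inv : forall X, hom X (X ⊗ unit_ob);
  runitK : forall X, runit_inv X ∘ runit X = idm _;
  runit_invK : forall X, runit X ∘ runit_inv X = idm _;
  runit_natural : forall (X Y : smc_cat) (f : hom X Y),
    runit Y ∘ (f ⊠ idm unit_ob) = f ∘ runit X;

  swap : forall X Y, hom (X ⊗ Y) (Y ⊗ X);
  swapK : forall X Y, swap Y X ∘ swap X Y = idm _;
  swap_natural : forall (X X' Y Y' : smc_cat) (f : hom X X') (g : hom Y Y'),
    swap X' Y' ∘ (f ⊠ g) = (g ⊠ f) ∘ swap X Y;

  pentagon : forall W X Y Z,
    assoc W X (Y ⊗ Z) ∘ assoc (W ⊗ X) Y Z
    = (idm W ⊠ assoc X Y Z) ∘ assoc W (X ⊗ Y) Z ∘ (assoc W X Y ⊠ idm Z);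
  triangle : forall X Y,
    (idm X ⊠ lunit Y) ∘ assoc X unit_ob Y = runit X ⊠ idm Y;
  hexagon : forall X Y Z,
    assoc Y Z X ∘ swap X (Y ⊗ Z) ∘ assoc X Y Z
    = (idm Y ⊠ swap X Z) ∘ assoc Y X Z ∘ (swap X Y ⊠ idm Z)
}.

Arguments tensor {C} X Y : rename.
Arguments tensor_hom {C X X' Y Y'} f g : rename.
Arguments unit_ob {C} : rename.
Arguments assoc {C} X Y Z : rename.
Arguments assoc_inv {C} X Y Z : rename.
Arguments lunit {C} X : rename.
Arguments lunit_inv {C} X : rename.
Arguments runit {C} X : rename.
Arguments runit_inv {C} X : rename.
Arguments swap {C} X Y : rename.
Notation "X ⊗ Y" := (tensor X Y) : markov_scope.
Notation "f ⊠ g" := (tensor_hom f g) : markov_scope.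

Definition middle_swap (C : symmetric_monoidal) (A B X Y : C) :
    hom ((A ⊗ B) ⊗ (X ⊗ Y)) ((A ⊗ X) ⊗ (B ⊗ Y)) :=
  assoc_inv A X (B ⊗ Y)
  ∘ (idm A ⊠ (assoc X B Y ∘ (swap B X ⊠ idm Y) ∘ assoc_inv B X Y))
  ∘ assoc A B (X ⊗ Y).

(* The nullary compatibilities del_I = id and copy_I = lunit_inv I follow from
   [del_natural] and the counit laws at I, so they are not fields. *)
Record markov_category := MarkovCategory {
  markov_smc :> symmetric_monoidal;

  copy : forall X : markov_smc, hom X (X ⊗ X);
  del : forall X : markov_smc, hom X unit_ob;

  copy_assoc : forall X,
    assoc X X X ∘ (copy X ⊠ idm X) ∘ copy X = (idm X ⊠ copy X) ∘ copy X;
  copy_counitl : forall X, lunit X ∘ (del X ⊠ idm X) ∘ copy X = idm X;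
  copy_counitr : forall X, runit X ∘ (idm X ⊠ del X) ∘ copy X = idm X;
  copy_comm : forall X, swap X X ∘ copy X = copy X;

  copy_tensor : forall X Y,
    copy (X ⊗ Y) = middle_swap X X Y Y ∘ (copy X ⊠ copy Y);
  del_tensor : forall X Y, del (X ⊗ Y) = lunit unit_ob ∘ (del X ⊠ del Y);

  del_natural : forall (X Y : markov_smc) (f : hom X Y), del Y ∘ f = del X
}.

Arguments copy {C} X : rename.
Arguments del {C} X : rename.

Definition has_conditionals (C : markov_category) : Prop :=
  forall (A X Y : C) (f : hom A (X ⊗ Y)),
  exists k : hom (X ⊗ A) Y,
    f = (idm X ⊠ k) ∘ assoc X X A ∘ (copy X ⊠ idm A)
        ∘ ((runit X ∘ (idm X ⊠ del Y) ∘ f) ⊠ idm A) ∘ copy A.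

Definition as_equal (C : markov_category) (A X W Y : C) (p : hom A X)
    (f1 f2 : hom (W ⊗ X) Y) : Prop :=
  (f1 ⊠ idm X) ∘ assoc_inv W X X ∘ (idm W ⊠ (copy X ∘ p))
  = (f2 ⊠ idm X) ∘ assoc_inv W X X ∘ (idm W ⊠ (copy X ∘ p)).

Definition abs_cont (C : markov_category) (A B X : C)
    (p : hom A X) (q : hom B X) : Prop :=
  forall (W Y : C) (f1 f2 : hom (W ⊗ X) Y),
    as_equal q f1 f2 -> as_equal p f1 f2.

Definition atomic_mor (C : markov_category) (A X : C) (p : hom A X) : Prop :=
  abs_cont (copy X ∘ p) (p ⊠ p).

Definition atomic (C : markov_category) : Prop :=
  forall (A X : C) (p : hom A X), atomic_mor p.

Definition cancellable (C : markov_category) (W : C) : Prop :=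
  forall (X Y : C) (f1 f2 : hom X Y), del W ⊠ f1 = del W ⊠ f2 -> f1 = f2.

Definition cancellative (C : markov_category) : Prop :=
  forall W : C, cancellable W.

(* Main.v *)
(** Let [p : X -> W] be the [W]-marginal of [f1] and [f2]: discarding [Y] in the
    hypothesis gives [p ⊗ del] on both sides, so cancellability of [W] makes the
    two marginals equal. Conditioning on [W] writes [g_i ∘ f_i] as
    [x ↦ G_i(w, x, w)] with [w ~ p(x)], while the hypothesis says that
    [(x, w') ↦ (G_i(w, x, w'), w)] does not depend on [i]. As the input [x] can be
    copied beforehand, [G_1(w, x, w') = G_2(w, x, w')] almost surely for two
    independent draws [(w, x)], [(w', x')] from the graph [⟨p, id⟩], hence, by
    atomicity of the graph, also almost surely on the diagonal. *)

From Corelib Require Import ssreflect ssrfun.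
Require Import Defs.

Set Implicit Arguments.
Unset Strict Implicit.
Unset Printing Implicit Defensive.

Local Open Scope markov_scope.

(** Lets an equation between composites rewrite the tail of a longer left-nested composite. *)
Lemma comp_reassoc (C : category) (X Y Z : C) (g : hom Y Z) (f : hom X Y)
    (h : hom X Z) :
  g ∘ f = h -> forall T (x : hom Z T), x ∘ g ∘ f = x ∘ h.
Proof. by move=> <- T x; rewrite comp_assoc. Qed.

Lemma comp_reassoc2 (C : category) (X Y Y' Z : C) (g : hom Y Z) (f : hom X Y)
    (g' : hom Y' Z) (f' : hom X Y') :
  g ∘ f = g' ∘ f' -> forall T (x : hom Z T), x ∘ g ∘ f = x ∘ g' ∘ f'.
Proof. by move=> e T x; rewrite -!comp_assoc e. Qed.

(** * Coherence in symmetric monoidal categories *)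

Section Monoidal.
Variable C : symmetric_monoidal.
Implicit Types A B D E V X Y Z W : C.

Lemma tensor_split X X' Y Y' (f : hom X X') (g : hom Y Y') :
  f ⊠ g = (f ⊠ idm _) ∘ (idm _ ⊠ g).
Proof. by rewrite -tensor_comp comp_idl comp_idr. Qed.

Lemma tensor_split' X X' Y Y' (f : hom X X') (g : hom Y Y') :
  f ⊠ g = (idm _ ⊠ g) ∘ (f ⊠ idm _).
Proof. by rewrite -tensor_comp comp_idl comp_idr. Qed.

Lemma tensor_compl X X' X'' Y (f' : hom X' X'') (f : hom X X') :
  (f' ∘ f) ⊠ idm Y = (f' ⊠ idm Y) ∘ (f ⊠ idm Y).
Proof. by rewrite -tensor_comp comp_idl. Qed.

Lemma tensor_compr X X' X'' Y (f' : hom X' X'') (f : hom X X') :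
  idm Y ⊠ (f' ∘ f) = (idm Y ⊠ f') ∘ (idm Y ⊠ f).
Proof. by rewrite -tensor_comp comp_idl. Qed.

Lemma assoc_inv_natural X X' Y Y' Z Z'
    (f : hom X X') (g : hom Y Y') (h : hom Z Z') :
  assoc_inv X' Y' Z' ∘ (f ⊠ (g ⊠ h)) = ((f ⊠ g) ⊠ h) ∘ assoc_inv X Y Z.
Proof.
rewrite -[LHS]comp_idr -(assoc_invK X Y Z) comp_assoc.
rewrite -(comp_assoc _ _ (assoc X Y Z)) -assoc_natural.
by rewrite !comp_assoc assocK comp_idl.
Qed.

Lemma assoc_epi X Y Z T (f g : hom (X ⊗ (Y ⊗ Z)) T) :
  f ∘ assoc X Y Z = g ∘ assoc X Y Z -> f = g.
Proof.
by move=> e; rewrite -[f]comp_idr -[g]comp_idr -assoc_invK !comp_assoc e.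
Qed.

Lemma assoc_mono X Y Z T (f g : hom T ((X ⊗ Y) ⊗ Z)) :
  assoc X Y Z ∘ f = assoc X Y Z ∘ g -> f = g.
Proof.
by move=> e; rewrite -[f]comp_idl -[g]comp_idl -assocK -!comp_assoc e.
Qed.

Lemma unit_tensor_inj X Y (f g : hom X Y) :
  idm unit_ob ⊠ f = idm unit_ob ⊠ g -> f = g.
Proof.
move=> e; rewrite -[f]comp_idr -[g]comp_idr -lunit_invK !comp_assoc.
by rewrite -!lunit_natural e.
Qed.

Lemma tensor_unit_inj X Y (f g : hom X Y) :
  f ⊠ idm unit_ob = g ⊠ idm unit_ob -> f = g.
Proof.
move=> e; rewrite -[f]comp_idr -[g]comp_idr -runit_invK !comp_assoc.
by rewrite -!runit_natural e.
Qed.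

(** Kelly's argument: tensoring with the unit is faithful and associators are invertible, so the
    claim reduces to the pentagon at [unit_ob], [unit_ob], [X], [Y], where the triangle law applies
    twice. *)
Lemma lunit_tensor X Y :
  lunit (X ⊗ Y) ∘ assoc unit_ob X Y = lunit X ⊠ idm Y.
Proof.
apply: unit_tensor_inj; apply: assoc_epi.
have iso : (assoc unit_ob unit_ob X ⊠ idm Y)
    ∘ (assoc_inv unit_ob unit_ob X ⊠ idm Y) = idm _.
  by rewrite -tensor_comp assoc_invK comp_idl tensor_idm.
rewrite -[LHS]comp_idr -[RHS]comp_idr -iso !comp_assoc; congr (_ ∘ _).
rewrite tensor_compr -!comp_assoc (comp_assoc (_ ⊠ assoc _ _ _)) -pentagon.
rewrite !comp_assoc triangle -tensor_idm -assoc_natural.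
by rewrite -assoc_natural -!comp_assoc -tensor_comp triangle comp_idl.
Qed.

Lemma runit_tensor X Y :
  (idm X ⊠ runit Y) ∘ assoc X Y unit_ob = runit (X ⊗ Y).
Proof.
apply: tensor_unit_inj; apply: assoc_mono.
rewrite -triangle -tensor_idm comp_assoc assoc_natural -comp_assoc pentagon.
rewrite !comp_assoc -tensor_compr triangle.
by rewrite -assoc_natural -comp_assoc -tensor_compl.
Qed.

(** Comes from the hexagon at [X], [unit_ob], [unit_ob]: postcomposing with [lunit] collapses the
    associators, and an invertible swap then cancels. *)
Lemma lunit_swap X : lunit X ∘ swap X unit_ob = runit X.
Proof.
apply: tensor_unit_inj.
rewrite -[LHS]comp_idl -[RHS]comp_idl -(swapK X unit_ob) -!comp_assoc.
congr (_ ∘ _).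
have := f_equal (comp (lunit _)) (hexagon X unit_ob unit_ob).
rewrite !comp_assoc lunit_tensor lunit_natural -swap_natural.
rewrite -(comp_assoc _ _ (assoc _ _ _)) triangle => ->.
by rewrite tensor_compl -(comp_assoc _ (lunit _)) lunit_tensor comp_assoc.
Qed.

Lemma runit_swap X : runit X ∘ swap unit_ob X = lunit X.
Proof. by rewrite -lunit_swap -comp_assoc swapK comp_idr. Qed.

Lemma triangle_inv X Y :
  (runit X ⊠ idm Y) ∘ assoc_inv X unit_ob Y = idm X ⊠ lunit Y.
Proof. by rewrite -triangle -comp_assoc assoc_invK comp_idr. Qed.

Lemma lunit_tensor_inv X Y :
  (lunit X ⊠ idm Y) ∘ assoc_inv unit_ob X Y = lunit (X ⊗ Y).
Proof. by rewrite -lunit_tensor -comp_assoc assoc_invK comp_idr. Qed.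

Lemma middle_swap_natural A A' B B' X X' Y Y' (a : hom A A') (b : hom B B')
    (x : hom X X') (y : hom Y Y') :
  middle_swap A' B' X' Y' ∘ ((a ⊠ b) ⊠ (x ⊠ y))
  = ((a ⊠ x) ⊠ (b ⊠ y)) ∘ middle_swap A B X Y.
Proof.
rewrite /middle_swap -!comp_assoc assoc_natural.
rewrite (comp_assoc (_ ⊠ _) (_ ⊠ _)) -tensor_comp comp_idl.
rewrite -!comp_assoc assoc_inv_natural (comp_assoc (swap _ _ ⊠ _)).
rewrite -tensor_comp swap_natural comp_idl -{1}[y]comp_idr tensor_comp.
rewrite (comp_assoc (assoc _ _ _)) (comp_assoc (assoc _ _ _)) assoc_natural.
rewrite -!(comp_assoc (x ⊠ (b ⊠ y))) -{1}[a]comp_idr tensor_comp.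
by rewrite !comp_assoc assoc_inv_natural.
Qed.

(** This and the next two lemmas are what is left of the projections of [middle_swap] once
    naturality has replaced discarded factors by units. *)
Lemma middle_swap_unit_outer X Y :
  (runit X ⊠ lunit Y) ∘ middle_swap X unit_ob unit_ob Y = runit X ⊠ lunit Y.
Proof.
rewrite /middle_swap tensor_split' !comp_assoc (comp_reassoc (triangle_inv _ _)).
rewrite -!tensor_compr !comp_assoc (comp_reassoc (lunit_tensor _ _)).
rewrite (comp_reassoc (esym (tensor_compl _ _ _))) lunit_swap.
rewrite (comp_reassoc (triangle_inv _ _)) tensor_compr -!comp_assoc.
rewrite -assoc_natural comp_assoc triangle tensor_idm.
by rewrite -tensor_split -tensor_split'.
Qed.

Lemma middle_swap_unit_right X Y :
  (runit X ⊠ runit Y) ∘ middle_swap X Y unit_ob unit_ob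
  = runit (X ⊗ Y) ∘ (idm _ ⊠ lunit unit_ob).
Proof.
rewrite /middle_swap tensor_split' !comp_assoc (comp_reassoc (triangle_inv _ _)).
rewrite -!tensor_compr !comp_assoc (comp_reassoc (lunit_tensor _ _)).
rewrite (comp_reassoc (esym (tensor_compl _ _ _))) lunit_swap.
rewrite (comp_reassoc (triangle_inv _ _)) tensor_compr -!comp_assoc.
by rewrite -assoc_natural comp_assoc runit_tensor tensor_idm.
Qed.

Lemma middle_swap_unit_left X Y :
  (lunit X ⊠ lunit Y) ∘ middle_swap unit_ob unit_ob X Y
  = lunit (X ⊗ Y) ∘ (lunit unit_ob ⊠ idm _).
Proof.
rewrite /middle_swap tensor_split' !comp_assoc.
rewrite (comp_reassoc (lunit_tensor_inv _ _)).
rewrite (comp_reassoc (lunit_natural _)) !comp_assoc.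
rewrite (comp_reassoc (lunit_tensor _ _)) triangle -tensor_compl runit_swap.
by rewrite lunit_tensor_inv.
Qed.

End Monoidal.

(** * Structural maps of a Markov category *)

Section Markov.
Variable C : markov_category.
Implicit Types A B D E V X Y Z W : C.

(* Locked, so that [rewrite comp_assoc] does not see through them. *)
Fact wiring_key : unit. Proof. exact: tt. Qed.

Definition pair A X Y (f : hom A X) (g : hom A Y) : hom A (X ⊗ Y) :=
  locked_with wiring_key ((f ⊠ g) ∘ copy A).

Definition fst_mor X Y : hom (X ⊗ Y) X :=
  locked_with wiring_key (runit X ∘ (idm X ⊠ del Y)).

Definition snd_mor X Y : hom (X ⊗ Y) Y :=
  locked_with wiring_key (lunit Y ∘ (del X ⊠ idm Y)).

Definition right_swap A B D : hom ((A ⊗ B) ⊗ D) ((A ⊗ D) ⊗ B) :=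
  locked_with wiring_key (assoc_inv A D B ∘ (idm A ⊠ swap B D) ∘ assoc A B D).

Definition deterministic X Y (f : hom X Y) : Prop :=
  copy Y ∘ f = (f ⊠ f) ∘ copy X.

Local Notation "⟨ f , g ⟩" := (pair f g) (format "⟨ f ,  g ⟩").
Local Notation π1 := (@fst_mor _ _).
Local Notation π2 := (@snd_mor _ _).

Lemma pair_def A X Y (f : hom A X) (g : hom A Y) : ⟨f, g⟩ = (f ⊠ g) ∘ copy A.
Proof. by rewrite /pair; case: wiring_key. Qed.

Lemma fst_def X Y : π1 = runit X ∘ (idm X ⊠ del Y).
Proof. by rewrite /fst_mor; case: wiring_key. Qed.

Lemma snd_def X Y : π2 = lunit Y ∘ (del X ⊠ idm Y).
Proof. by rewrite /snd_mor; case: wiring_key. Qed.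

Lemma right_swap_def A B D :
  right_swap A B D = assoc_inv A D B ∘ (idm A ⊠ swap B D) ∘ assoc A B D.
Proof. by rewrite /right_swap; case: wiring_key. Qed.

Lemma fst_tensor X X' Y Y' (f : hom X X') (g : hom Y Y') :
  π1 ∘ (f ⊠ g) = f ∘ π1.
Proof.
rewrite !fst_def -comp_assoc -tensor_comp del_natural comp_idl.
by rewrite tensor_split comp_assoc runit_natural comp_assoc.
Qed.

Lemma snd_tensor X X' Y Y' (f : hom X X') (g : hom Y Y') :
  π2 ∘ (f ⊠ g) = g ∘ π2.
Proof.
rewrite !snd_def -comp_assoc -tensor_comp del_natural comp_idl.
by rewrite tensor_split' comp_assoc lunit_natural comp_assoc.
Qed.

Lemma fst_copy X : π1 ∘ copy X = idm X.
Proof. by rewrite fst_def copy_counitr. Qed.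

Lemma snd_copy X : π2 ∘ copy X = idm X.
Proof. by rewrite snd_def copy_counitl. Qed.

Lemma fst_pair A X Y (f : hom A X) (g : hom A Y) : π1 ∘ ⟨f, g⟩ = f.
Proof. by rewrite !pair_def comp_assoc fst_tensor -comp_assoc fst_copy comp_idr. Qed.

Lemma snd_pair A X Y (f : hom A X) (g : hom A Y) : π2 ∘ ⟨f, g⟩ = g.
Proof. by rewrite !pair_def comp_assoc snd_tensor -comp_assoc snd_copy comp_idr. Qed.

Lemma tensor_pair A X X' Y Y' (f' : hom X X') (g' : hom Y Y')
    (f : hom A X) (g : hom A Y) :
  (f' ⊠ g') ∘ ⟨f, g⟩ = ⟨f' ∘ f, g' ∘ g⟩.
Proof. by rewrite !pair_def comp_assoc tensor_comp. Qed.

(** Copying is not natural, hence the restriction on [d]: a random [d] would be sampled twice on the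
    right and once on the left. *)
Lemma pair_comp B A X Y (f : hom A X) (g : hom A Y) (d : hom B A) :
  deterministic d -> ⟨f, g⟩ ∘ d = ⟨f ∘ d, g ∘ d⟩.
Proof. by move=> dd; rewrite !pair_def tensor_comp -!comp_assoc dd. Qed.

Lemma fst_middle_swap X X' Y Y' :
  (π1 ⊠ π1) ∘ middle_swap X X' Y Y' = π1.
Proof.
rewrite !fst_def tensor_comp (comp_reassoc2 (esym (middle_swap_natural _ _ _ _))).
rewrite middle_swap_unit_right -comp_assoc !tensor_idm -tensor_comp.
by rewrite comp_idl -del_tensor.
Qed.

Lemma snd_middle_swap X X' Y Y' :
  (π2 ⊠ π2) ∘ middle_swap X X' Y Y' = π2.
Proof.
rewrite !snd_def tensor_comp (comp_reassoc2 (esym (middle_swap_natural _ _ _ _))).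
rewrite middle_swap_unit_left -comp_assoc !tensor_idm -tensor_comp.
by rewrite comp_idl -del_tensor.
Qed.

Lemma fst_snd_middle_swap X X' Y Y' :
  (π1 ⊠ π2) ∘ middle_swap X X' Y Y' = π1 ⊠ π2.
Proof.
rewrite !fst_def !snd_def !tensor_comp.
rewrite (comp_reassoc2 (esym (middle_swap_natural _ _ _ _))).
by rewrite middle_swap_unit_outer.
Qed.

Lemma pair_fst_snd X Y : ⟨π1, π2⟩ = idm (X ⊗ Y).
Proof.
rewrite !pair_def copy_tensor comp_assoc fst_snd_middle_swap -tensor_comp.
by rewrite fst_copy snd_copy tensor_idm.
Qed.

Lemma det_fst X Y : deterministic (@fst_mor X Y).
Proof.
by rewrite /deterministic copy_tensor comp_assoc fst_middle_swap fst_tensor.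
Qed.

Lemma det_snd X Y : deterministic (@snd_mor X Y).
Proof.
by rewrite /deterministic copy_tensor comp_assoc snd_middle_swap snd_tensor.
Qed.

Lemma det_idm X : deterministic (idm X).
Proof. by rewrite /deterministic tensor_idm comp_idl comp_idr. Qed.

Lemma det_comp X Y Z (g : hom Y Z) (f : hom X Y) :
  deterministic g -> deterministic f -> deterministic (g ∘ f).
Proof.
move=> dg df; rewrite /deterministic comp_assoc dg -comp_assoc df.
by rewrite comp_assoc -tensor_comp.
Qed.

(** Marginals do not determine a joint morphism in general, but deterministic morphisms carry no
    correlations beyond them; on these the tensor behaves as a cartesian product. *)
Lemma pair_ext A X Y (f g : hom A (X ⊗ Y)) :
  deterministic f -> deterministic g ->
  π1 ∘ f = π1 ∘ g -> π2 ∘ f = π2 ∘ g -> f = g.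
Proof.
move=> df dg e1 e2; rewrite -[f]comp_idl -[g]comp_idl -pair_fst_snd.
by rewrite !pair_comp // e1 e2.
Qed.

Lemma tensorE X X' Y Y' (f : hom X X') (g : hom Y Y') :
  f ⊠ g = ⟨f ∘ π1, g ∘ π2⟩.
Proof. by rewrite -tensor_pair pair_fst_snd comp_idr. Qed.

Lemma copyE X : copy X = ⟨idm X, idm X⟩.
Proof. by rewrite !pair_def tensor_idm comp_idl. Qed.

Lemma swap_pair A X Y (f : hom A X) (g : hom A Y) :
  swap X Y ∘ ⟨f, g⟩ = ⟨g, f⟩.
Proof. by rewrite !pair_def comp_assoc swap_natural -comp_assoc copy_comm. Qed.

(** Naturality of [assoc] moves [f], [g], [h] out of the way, and coassociativity of [copy A]
    remains. No determinism is involved. *)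
Lemma assoc_pair A X Y Z (f : hom A X) (g : hom A Y) (h : hom A Z) :
  assoc X Y Z ∘ ⟨⟨f, g⟩, h⟩ = ⟨f, ⟨g, h⟩⟩.
Proof.
have -> : ⟨⟨f, g⟩, h⟩ = ((f ⊠ g) ⊠ h) ∘ ⟨copy A, idm A⟩.
  by rewrite tensor_pair -pair_def comp_idr.
have -> : ⟨f, ⟨g, h⟩⟩ = (f ⊠ (g ⊠ h)) ∘ ⟨idm A, copy A⟩.
  by rewrite tensor_pair -pair_def comp_idr.
by rewrite comp_assoc assoc_natural -!comp_assoc !pair_def -copy_assoc -!comp_assoc.
Qed.

Lemma assoc_inv_pair A X Y Z (f : hom A X) (g : hom A Y) (h : hom A Z) :
  assoc_inv X Y Z ∘ ⟨f, ⟨g, h⟩⟩ = ⟨⟨f, g⟩, h⟩.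
Proof. by rewrite -assoc_pair comp_assoc assocK comp_idl. Qed.

Lemma swapE X Y : swap X Y = ⟨π2, π1⟩.
Proof. by rewrite -(swap_pair π1) pair_fst_snd comp_idr. Qed.

Lemma assocE X Y Z :
  assoc X Y Z = ⟨π1 ∘ π1, ⟨π2 ∘ π1, π2⟩⟩.
Proof.
rewrite -assoc_pair -(pair_comp _ _ (@det_fst _ _)).
by rewrite pair_fst_snd comp_idl pair_fst_snd comp_idr.
Qed.

Lemma assoc_invE X Y Z :
  assoc_inv X Y Z = ⟨⟨π1, π1 ∘ π2⟩, π2 ∘ π2⟩.
Proof.
rewrite -assoc_inv_pair -(pair_comp _ _ (@det_snd _ _)).
by rewrite pair_fst_snd comp_idl pair_fst_snd comp_idr.
Qed.

Lemma del_tensor_snd X Y W (f : hom X Y) :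
  del W ⊠ f = lunit_inv Y ∘ (f ∘ π2).
Proof.
rewrite !snd_def (comp_assoc f) -lunit_natural !comp_assoc lunitK comp_idl.
by rewrite -tensor_split'.
Qed.

Lemma middle_swap_pair A X X' Y Y'
    (f : hom A X) (f' : hom A X') (g : hom A Y) (g' : hom A Y') :
  middle_swap X X' Y Y' ∘ ⟨⟨f, f'⟩, ⟨g, g'⟩⟩ = ⟨⟨f, g⟩, ⟨f', g'⟩⟩.
Proof.
rewrite /middle_swap -!comp_assoc assoc_pair tensor_pair comp_idl -!comp_assoc.
by rewrite assoc_inv_pair tensor_pair swap_pair comp_idl assoc_pair assoc_inv_pair.
Qed.

Lemma det_pair A X Y (f : hom A X) (g : hom A Y) :
  deterministic f -> deterministic g -> deterministic ⟨f, g⟩.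
Proof.
move=> df dg; rewrite /deterministic copy_tensor -comp_assoc tensor_pair df dg.
by rewrite -!pair_def middle_swap_pair pair_def.
Qed.

Ltac det := repeat first [ apply: det_fst | apply: det_snd | apply: det_idm
                         | apply: det_pair | apply: det_comp ].

(* Two composites of structural maps agree as soon as all their projections
   do. *)
Ltac project :=
  rewrite -?comp_assoc ?comp_idl ?comp_idr ?fst_pair ?snd_pair.

Ltac wiring :=
  rewrite ?right_swap_def ?tensorE ?assocE ?assoc_invE ?swapE ?copyE;
  repeat first [progress project | rewrite pair_comp; [solve [det]|]];
  repeat (apply: pair_ext; [solve [det] | solve [det] | project | project]);
  done.

Lemma right_swap_natural A A' B B' D D' (a : hom A A') (b : hom B B')
    (d : hom D D') :
  right_swap A' B' D' ∘ ((a ⊠ b) ⊠ d) = ((a ⊠ d) ⊠ b) ∘ right_swap A B D.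
Proof.
rewrite !right_swap_def -!comp_assoc assoc_natural (comp_assoc (idm _ ⊠ _)).
rewrite -tensor_comp swap_natural comp_idl -{1}[a]comp_idr tensor_comp.
by rewrite !comp_assoc assoc_inv_natural.
Qed.

Lemma right_swapE A B D :
  right_swap A B D = ⟨⟨π1 ∘ π1, π2⟩, π2 ∘ π1⟩.
Proof. wiring. Qed.

Lemma snd_right_swap A B D : π2 ∘ right_swap A B D = π2 ∘ π1.
Proof. by rewrite right_swapE snd_pair. Qed.

(** * Cancellation and combs *)

Lemma cancel_fst X Y W (p q : hom X Y) :
  cancellable W -> p ∘ @fst_mor X W = q ∘ @fst_mor X W -> p = q.
Proof.
move=> cW e; apply: cW; rewrite !del_tensor_snd.
have -> : π2 = π1 ∘ swap W X by wiring.
by rewrite !(comp_assoc _ π1) e.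
Qed.

(** A comb with memory [E] and a hole from [W] to [W]: the [W] emitted by [f] is exposed as an
    output, and [g] reads an external [W] instead. Filling the hole with the identity gives
    [g ∘ f]. *)
Definition comb X Y W E (f : hom X (E ⊗ W)) (g : hom (E ⊗ W) Y) :
    hom (X ⊗ W) (Y ⊗ W) :=
  (g ⊠ idm W) ∘ right_swap E W W ∘ (f ⊠ idm W).

Lemma snd_comb X Y W E (f : hom X (E ⊗ W)) (g : hom (E ⊗ W) Y) :
  π2 ∘ comb f g = (π2 ∘ f) ∘ π1.
Proof.
rewrite /comb !comp_assoc snd_tensor comp_idl snd_right_swap.
by rewrite -comp_assoc fst_tensor comp_assoc.
Qed.

(** * Conditioning along the graph of the marginal *)

Section Graph.
Variables (X Y W : C) (p : hom X W).
Let P := W ⊗ X.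
Let graph : hom X P := ⟨p, idm X⟩.

(** Conditionals condition on the first tensor factor, so [f] is swapped first and swapped back
    afterwards. The graph supplies both arguments of the conditional, the sampled [W] and the input
    [X]. *)
Lemma conditional_graph E (f : hom X (E ⊗ W)) :
  has_conditionals C -> π2 ∘ f = p ->
  exists k : hom P E, f = (k ⊠ idm W) ∘ ⟨idm P, π1⟩ ∘ graph.
Proof.
move=> condC fp; have [k fk] := condC _ _ _ (swap E W ∘ f); exists k.
rewrite -[LHS]comp_idl -(swapK E W) -comp_assoc {}fk.
have -> : runit W ∘ (idm W ⊠ del E) ∘ (swap E W ∘ f) = p.
  rewrite -fst_def -fp comp_assoc; congr (_ ∘ _); wiring.
rewrite -[_ ∘ (p ⊠ idm X) ∘ copy X]comp_assoc -pair_def -/graph.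
rewrite !comp_assoc swap_natural -!comp_assoc; congr (_ ∘ _).
by rewrite !comp_assoc; congr (_ ∘ _); wiring.
Qed.

(** The graph outputs its input unchanged, so by coassociativity that input may be copied before or
    after the graph is run. *)
Lemma graph_copy : (graph ⊠ idm X) ∘ copy X = ⟨idm P, π2⟩ ∘ graph.
Proof.
have -> : ⟨idm P, π2⟩ = assoc_inv W X X ∘ (idm W ⊠ copy X).
  by wiring.
rewrite -comp_assoc tensor_pair comp_idl comp_idr [in RHS]copyE.
by rewrite assoc_inv_pair pair_def.
Qed.

Lemma graph_tensor_copy :
  ((graph ⊠ idm W) ⊠ idm X) ∘ ⟨idm (X ⊗ W), π1⟩
  = ⟨idm (P ⊗ W), π2 ∘ π1⟩ ∘ (graph ⊠ idm W).
Proof.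
have -> : ⟨idm (X ⊗ W), π1⟩ = right_swap X X W ∘ (copy X ⊠ idm W).
  by wiring.
rewrite comp_assoc -right_swap_natural -comp_assoc -tensor_compl graph_copy.
by rewrite tensor_compl comp_assoc; congr (_ ∘ _); wiring.
Qed.

(* The hypothesis of the theorem only copies the [W] part of [graph]; since
   [X] is an input, it can be copied too, before [graph] is run. *)
Lemma comb_graph (G : hom (P ⊗ W) Y) :
  (G ⊠ idm P) ∘ ⟨idm (P ⊗ W), π1⟩ ∘ (graph ⊠ idm W)
  = assoc Y W X
    ∘ (((G ⊠ idm W) ∘ ⟨idm (P ⊗ W), π1 ∘ π1⟩ ∘ (graph ⊠ idm W)) ⊠ idm X)
    ∘ ⟨idm (X ⊗ W), π1⟩.
Proof.
rewrite !tensor_compl -!comp_assoc graph_tensor_copy (comp_assoc (assoc _ _ _)).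
rewrite assoc_natural !comp_assoc -!(comp_assoc (G ⊠ _)) tensor_idm.
by congr (_ ∘ (_ ∘ _)); wiring.
Qed.

(** [G] takes its [P] from the first draw and its [W] from the second. The ignored wire [V] is there
    only to match the shape required by [as_equal]. *)
Definition second_draw (V : C) (G : hom (P ⊗ W) Y) : hom (V ⊗ (P ⊗ P)) Y :=
  G ∘ (idm P ⊠ π1) ∘ π2.

(** The draws are independent, so the second can be made beforehand and its [W] part fed into the
    open input of the expression in [comb_graph]. Thus the left side depends on [G] only through
    that expression. *)
Lemma second_draw_product (V : C) (G : hom (P ⊗ W) Y) :
  (second_draw V G ⊠ idm (P ⊗ P)) ∘ assoc_inv V (P ⊗ P) (P ⊗ P)
    ∘ (idm V ⊠ (copy (P ⊗ P) ∘ (graph ⊠ graph)))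
  = assoc Y P P
    ∘ (((G ⊠ idm P) ∘ ⟨idm (P ⊗ W), π1⟩ ∘ (graph ⊠ idm W)) ⊠ idm P)
    ∘ assoc_inv X W P ∘ (idm X ⊠ (⟨π1, idm P⟩ ∘ graph)) ∘ π2.
Proof.
(* The idle wire [V] is first split off as a projection. *)
transitivity
  ((G ⊠ idm (P ⊗ P)) ∘ ⟨idm P ⊠ π1, idm (P ⊗ P)⟩ ∘ (graph ⊠ graph)
    ∘ @snd_mor V (X ⊗ X)).
  rewrite /second_draw -(comp_assoc G) tensor_compl tensor_compr !comp_assoc.
  rewrite -(comp_assoc _ (graph ⊠ graph)).
  rewrite -(snd_tensor (idm V) (graph ⊠ graph)) !comp_assoc.
    congr (_ ∘ _); rewrite -!comp_assoc; congr (_ ∘ _); wiring.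
congr (_ ∘ _).
rewrite !tensor_compl !comp_assoc assoc_natural.
rewrite (comp_reassoc2 (esym (assoc_inv_natural _ _ _))) !tensor_idm.
rewrite (comp_reassoc (esym (tensor_split _ _))).
(* Both draws are brought to the front, where [graph ⊠ graph] cancels; after [G] cancels too, only
   structural maps remain. *)
rewrite -{3}[graph]comp_idl tensor_comp !comp_assoc; congr (_ ∘ _).
by rewrite -!(comp_assoc (G ⊠ _)); congr (_ ∘ _); wiring.
Qed.

(** When the two draws are copies of one, [G] reads the same [w] in both places. The outer [π1]
    drops the retained draws, and [a] merely fills the idle wire. *)
Lemma second_draw_copy (V : C) (a : hom X V) (G : hom (P ⊗ W) Y) :
  π1 ∘ ((second_draw V G ⊠ idm (P ⊗ P)) ∘ assoc_inv V (P ⊗ P) (P ⊗ P)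
    ∘ (idm V ⊠ (copy (P ⊗ P) ∘ (copy P ∘ graph)))) ∘ ⟨a, idm X⟩
  = G ∘ ⟨idm P, π1⟩ ∘ graph.
Proof.
rewrite !comp_assoc fst_tensor -!comp_assoc tensor_pair comp_idl comp_idr.
rewrite /second_draw -?comp_assoc; congr (_ ∘ _).
have discard : (idm P ⊠ @fst_mor W X) ∘ (@snd_mor V (P ⊗ P)
    ∘ (π1 ∘ (assoc_inv V (P ⊗ P) (P ⊗ P) ∘ (idm V ⊠ copy (P ⊗ P)))))
    ∘ (idm V ⊠ copy P) = ⟨idm P, π1⟩ ∘ π2.
  by wiring.
have -> : ⟨a, copy (P ⊗ P) ∘ (copy P ∘ graph)⟩
    = (idm V ⊠ copy (P ⊗ P)) ∘ ((idm V ⊠ copy P) ∘ ⟨a, graph⟩).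
  by rewrite !tensor_pair !comp_idl.
rewrite !comp_assoc in discard *; rewrite discard.
by rewrite -comp_assoc snd_pair.
Qed.

(** The conditional acts on the memory wire alone, so naturality of [right_swap] slides it from [f]
    into [g]. Combs with different memories thereby acquire the common memory [P]. *)
Lemma comb_conditional E (k : hom P E) (f : hom X (E ⊗ W))
    (g : hom (E ⊗ W) Y) :
  f = (k ⊠ idm W) ∘ ⟨idm P, π1⟩ ∘ graph ->
  comb f g = ((g ∘ (k ⊠ idm W)) ⊠ idm W) ∘ ⟨idm (P ⊗ W), π1 ∘ π1⟩
             ∘ (graph ⊠ idm W).
Proof.
move=> ->; rewrite /comb !tensor_compl !comp_assoc.
rewrite (comp_reassoc2 (right_swap_natural _ _ _)).
congr (_ ∘ _); rewrite -!comp_assoc; do 2 congr (_ ∘ _); wiring.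
Qed.

Lemma atomic_second_draw (G1 G2 : hom (P ⊗ W) Y) :
  atomic_mor graph ->
  (G1 ⊠ idm W) ∘ ⟨idm (P ⊗ W), π1 ∘ π1⟩ ∘ (graph ⊠ idm W)
  = (G2 ⊠ idm W) ∘ ⟨idm (P ⊗ W), π1 ∘ π1⟩ ∘ (graph ⊠ idm W) ->
  G1 ∘ ⟨idm P, π1⟩ ∘ graph = G2 ∘ ⟨idm P, π1⟩ ∘ graph.
Proof.
(* The idle wire is taken to be [X], filled by the identity; any object receiving a morphism from
   [X] would serve. *)
move=> atomic_graph eqG; rewrite -!(second_draw_copy (idm X)).
congr (_ ∘ _ ∘ _); apply: (atomic_graph X Y).
by rewrite /as_equal !second_draw_product !comb_graph eqG.
Qed.

End Graph.
End Markov.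

Theorem lemma12 (C : markov_category)
    (C_cancellative : cancellative C)
    (C_atomic : atomic C)
    (C_conditionals : has_conditionals C)
    (X Y W E1 E2 : C)
    (f1 : hom X (E1 ⊗ W)) (f2 : hom X (E2 ⊗ W))
    (g1 : hom (E1 ⊗ W) Y) (g2 : hom (E2 ⊗ W) Y) :
  (g1 ⊠ idm W) ∘ assoc_inv E1 W W ∘ (idm E1 ⊠ swap W W) ∘ assoc E1 W W
    ∘ (f1 ⊠ idm W)
  = (g2 ⊠ idm W) ∘ assoc_inv E2 W W ∘ (idm E2 ⊠ swap W W) ∘ assoc E2 W W
    ∘ (f2 ⊠ idm W) ->
  g1 ∘ f1 = g2 ∘ f2.
Proof.
move=> eq_plugged.
have eq_comb : comb f1 g1 = comb f2 g2.
  by rewrite /comb !right_swap_def !comp_assoc.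
set p := snd_mor E1 W ∘ f1.
have f2p : snd_mor E2 W ∘ f2 = p.
  apply: (cancel_fst (C_cancellative W)).
  by rewrite /p -(snd_comb f1 g1) -(snd_comb f2 g2) eq_comb.
have [k1 f1k] := conditional_graph C_conditionals (erefl p).
have [k2 f2k] := conditional_graph C_conditionals f2p.
(* Both sides now have the form [G ∘ ⟨idm P, π1⟩ ∘ graph], with [G] being [g1] or [g2] precomposed
   with its conditional. *)
rewrite f1k f2k !comp_assoc.
apply: atomic_second_draw; first exact: C_atomic.
by rewrite -(comb_conditional _ f1k) -(comb_conditional _ f2k).
Qed.
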